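(* For every integer $k \ge 2$ and every $\varepsilon >0$ there is a $\delta > 0$ such that every directed $k$-graph $H$ (on vertex set $[n]$, for any $n$) satisfying $\mathrm{Disc}(\delta)$ also satisfies $\mathrm{Eig}(\varepsilon)$.
   Context: Let $[n]=\{1,\dots,n\}$. A directed $k$-graph is $H=([n],E)$ where $E$ is a set of $k$-tuples of pairwise distinct elements of $[n]$. For $S_1,\ldots,S_k\subseteq[n]$, $e(S_1,\ldots,S_k)$ is the number of edges $(i_1,\ldots,i_k)\in E$ with $i_\ell\in S_\ell$ for all $\ell\in[k]$. A tensor $\tau=(\tau_{i_1\cdots i_k})\in\mathbb{R}^{[n]^k}$ acts as a $k$-linear form $\tau(\boldsymbol{u}_1,\ldots,\boldsymbol{u}_k)=\sum_{i_1,\ldots,i_k\in[n]}\tau_{i_1\cdots i_k}\boldsymbol{u}_1(i_1)\cdots\boldsymbol{u}_k(i_k)$, and its top eigenvalue is $\lambda_{\max}(\tau)=\sup|\tau(\boldsymbol{u}_1,\ldots,\boldsymbol{u}_k)|$ over all $\boldsymbol{u}_1,\ldots,\boldsymbol{u}_k\in\mathbb{R}^n$ of Euclidean norm $1$. The adjacency tensor $\tau_H\in\mathbb{R}^{[n]^k}$ has entry $1$ at $(i_1,\ldots,i_k)$ if $(i_1,\ldots,i_k)\in E$ and $0$ otherwise. With $p=|E|/n^k$ and $\boldsymbol{1}^{\otimes k}$ the all-ones tensor, the second eigenvalue of $H$ is $\lambda_2(H)=\lambda_{\max}(\tau_H-p\boldsymbol{1}^{\otimes k})$. $\mathrm{Disc}(\delta)$: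 there is a $q\in[0,1]$ such that $|e(S_1,\ldots,S_k)-q|S_1|\cdots|S_k||\le\delta n^k$ for all $S_1,\ldots,S_k\subseteq[n]$. $\mathrm{Eig}(\varepsilon)$: $\lambda_2(H)\le\varepsilon n^{k/2}$. *)

(* Defs.v *)
From HB Require Import structures.
From mathcomp Require Import all_boot all_order all_algebra.
From mathcomp Require Import all_classical all_reals all_analysis.

Set Implicit Arguments.
Unset Strict Implicit.
Unset Printing Implicit Defensive.

Import Order.TTheory GRing.Theory Num.Theory.

Local Open Scope ring_scope.

(* The vertex set [n] is 'I_n and a k-tuple of vertices is a k.-tuple 'I_n. *)
Record dikgraph (k n : nat) := DiKGraph {
  edges : {set k.-tuple 'I_n};
  edges_uniq : forall t : k.-tuple 'I_n, t \in edges -> uniq t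
}.

Definition edge_count (k n : nat) (H : dikgraph k n)
    (S : 'I_k -> {set 'I_n}) : nat :=
  #|[set t in edges H | [forall l : 'I_k, tnth t l \in S l]]|.

Definition tensor (R : realType) (k n : nat) := {ffun k.-tuple 'I_n -> R}.

Definition tensor_form (R : realType) (k n : nat) (tau : tensor R k n)
    (u : 'I_k -> 'rV[R]_n) : R :=
  \sum_(t : k.-tuple 'I_n) tau t * \prod_(l < k) u l ord0 (tnth t l).

(* The library norm on matrices is the maximum norm, hence this definition. *)
Definition norm2 (R : realType) (n : nat) (v : 'rV[R]_n) : R :=
  Num.sqrt (\sum_(i < n) v ord0 i ^+ 2).

(* The set below is always bounded, by \sum_t `|tau t|; it is empty only for
   n = 0 < k, and then the library's sup returns 0. *)
Definition lambda_max (R : realType) (k n : nat) (tau : tensor R k n) : R :=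
  sup [set x : R | exists u : 'I_k -> 'rV[R]_n,
    (forall l : 'I_k, norm2 (u l) = 1) /\ x = `|tensor_form tau u|]%classic.

Definition adjacency_tensor (R : realType) (k n : nat) (H : dikgraph k n) :
    tensor R k n :=
  [ffun t => (t \in edges H)%:R].

Definition density (R : realType) (k n : nat) (H : dikgraph k n) : R :=
  #|edges H|%:R / n%:R ^+ k.

Definition ones_tensor (R : realType) (k n : nat) : tensor R k n := [ffun=> 1].

Definition lambda2 (R : realType) (k n : nat) (H : dikgraph k n) : R :=
  lambda_max [ffun t => adjacency_tensor R H t
                        - density R H * ones_tensor R k n t].

Definition Disc (R : realType) (k n : nat) (delta : R) (H : dikgraph k n) :
    Prop :=
  exists q : R, (0 <= q <= 1) /\
    forall S : 'I_k -> {set 'I_n},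
      `|(edge_count H S)%:R - q * \prod_(l < k) #|S l|%:R|
        <= delta * n%:R ^+ k.

Definition Eig (R : realType) (k n : nat) (eps : R) (H : dikgraph k n) :
    Prop :=
  lambda2 R H <= eps * (n%:R `^ (k%:R / 2)).

(* Main.v *)
Require Import Defs.
From mathcomp Require Import all_boot all_order all_algebra.
From mathcomp Require Import all_classical all_reals all_analysis.
From mathcomp Require Import ring lra.
Import Order.TTheory GRing.Theory Num.Theory.
Local Open Scope ring_scope.

(** Rescale the unit vectors by [sqrt n], so that their squared norm is [n] and
    it suffices to bound the form of the deviation tensor by [eps * n ^ k].
    Cutting off the entries larger than [T] in one slot changes the form by at
    most [n ^ k / T], since the part cut off has l1-norm at most [n / T] and the
    tensor entries are at most 1 in absolute value.  Once all entries are at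
    most [T], the form is linear in each slot, so replacing a slot by an
    indicator costs a factor [2 * T]; on indicators the discrepancy hypothesis
    applies, and taking all [S l] full shows that the [q] there is within
    [delta] of the density. *)

Section TensorForm.
Variables (R : realType) (k n : nat).
Implicit Types (tau : tensor R k n) (u : 'I_k -> 'rV[R]_n) (v w : 'rV[R]_n).
Implicit Types (l m : 'I_k) (i : 'I_n) (S : 'I_k -> {set 'I_n}) (T : R).

Definition replace u l v : 'I_k -> 'rV[R]_n := fun m => if m == l then v else u m.

(** With every other slot frozen, the form is linear in slot [l]; these are its coefficients, and
    they do not depend on [u l]. *)
Definition slot_coef tau u l i : R :=
  \sum_(t : k.-tuple 'I_n | tnth t l == i)
    tau t * \prod_(m < k | m != l) u m ord0 (tnth t m).

Definition norm1 v : R := \sum_i `|v ord0 i|.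

Definition indicator (A : {set 'I_n}) : 'rV[R]_n := \row_i (i \in A)%:R.

Definition low_part T v : 'rV[R]_n :=
  \row_i (if `|v ord0 i| <= T then v ord0 i else 0).

Lemma eq_tensor_form tau u u' : (forall l, u l = u' l) ->
  tensor_form tau u = tensor_form tau u'.
Proof.
move=> uu'; apply: eq_bigr => t _; congr (_ * _).
by apply: eq_bigr => l _; rewrite uu'.
Qed.

Lemma replace_id u l m : replace u l (u l) m = u m.
Proof. by rewrite /replace; case: eqP => [->|]. Qed.

Lemma tensor_form_replace tau u l v :
  tensor_form tau (replace u l v) = \sum_i slot_coef tau u l i * v ord0 i.
Proof.
rewrite /tensor_form (partition_big (fun t => tnth t l) xpredT)//=.
apply: eq_bigr => i _; rewrite /slot_coef mulr_suml; apply: eq_bigr => t /eqP ti.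
rewrite (bigD1 l)//= {1}/replace eqxx ti -!mulrA; congr (_ * _).
rewrite mulrC; congr (_ * _); apply: eq_bigr => m /negPf ml.
by rewrite /replace ml.
Qed.

Lemma tensor_form_replaceB tau u l v w :
  tensor_form tau (replace u l (v - w)) =
  tensor_form tau (replace u l v) - tensor_form tau (replace u l w).
Proof.
rewrite !tensor_form_replace -sumrB; apply: eq_bigr => i _.
by rewrite !mxE mulrBr.
Qed.

Lemma tensor_formZ tau u c :
  tensor_form tau (fun l => c *: u l) = c ^+ k * tensor_form tau u.
Proof.
rewrite /tensor_form mulr_sumr; apply: eq_bigr => t _.
under eq_bigr do rewrite mxE.
by rewrite big_split /= prodr_const card_ord mulrCA.
Qed.

Lemma sum_tuple_prod (F : 'I_k -> 'I_n -> R) :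
  \sum_(t : k.-tuple 'I_n) \prod_(l < k) F l (tnth t l) =
  \prod_(l < k) \sum_i F l i.
Proof.
rewrite bigA_distr_bigA /=.
rewrite (reindex (fun f : {ffun 'I_k -> 'I_n} => [tuple f l | l < k])) /=; last first.
  exists (fun t : k.-tuple 'I_n => [ffun l => tnth t l]) => x _.
    by apply/ffunP => l; rewrite ffunE tnth_mktuple.
  by apply: eq_from_tnth => l; rewrite tnth_mktuple ffunE.
by apply: eq_bigr => f _; apply: eq_bigr => l _; rewrite tnth_mktuple.
Qed.

Lemma tensor_form_le_norm1 tau u : (forall t, `|tau t| <= 1) ->
  `|tensor_form tau u| <= \prod_(l < k) norm1 (u l).
Proof.
move=> tau1; rewrite -sum_tuple_prod.
apply: le_trans (ler_norm_sum _ _ _) _; apply: ler_sum => t _.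
by rewrite normrM normr_prod ler_piMl// prodr_ge0.
Qed.

(** Sum [2 * x <= 1 + x ^ 2] over the absolute values of the [n] entries. *)
Lemma norm1_le v : \sum_i v ord0 i ^+ 2 <= n%:R -> norm1 v <= n%:R.
Proof.
move=> v2; suff : 2 * norm1 v <= n%:R + \sum_i v ord0 i ^+ 2 by lra.
have -> : n%:R = \sum_(i < n) (1 : R) by rewrite sumr_const card_ord.
rewrite -big_split /norm1 mulr_sumr /=; apply: ler_sum => i _.
rewrite -(real_normK (num_real (v ord0 i))).
have := sqr_ge0 (`|v ord0 i| - 1); nra.
Qed.

Lemma low_part_bound T v i : 0 <= T -> `|low_part T v ord0 i| <= T.
Proof. by move=> T0; rewrite mxE; case: ifP => // _; rewrite normr0. Qed.

Lemma low_part_sqr T v :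
  \sum_i low_part T v ord0 i ^+ 2 <= \sum_i v ord0 i ^+ 2.
Proof.
by apply: ler_sum => i _; rewrite mxE; case: ifP => // _; rewrite expr0n sqr_ge0.
Qed.

(* An entry of size at least [T] is at most its square divided by [T]. *)
Lemma norm1_high_part T v : 0 < T -> \sum_i v ord0 i ^+ 2 <= n%:R ->
  norm1 (v - low_part T v) <= n%:R / T.
Proof.
move=> T0 v2; rewrite ler_pdivlMr//; apply: le_trans v2.
rewrite /norm1 mulr_suml; apply: ler_sum => i _; rewrite !mxE.
case: (leP `|v ord0 i| T) => [_|Tv]; first by rewrite /= subrr normr0 mul0r sqr_ge0.
rewrite /= subr0 -(real_normK (num_real (v ord0 i))) expr2.
by rewrite ler_wpM2l// ltW.
Qed.

(** Induction on [s], which lists the slots that may still have entries above [T]; each slot costs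
    one term [n ^ k / T]. *)
Lemma tensor_form_truncate tau T (B : R) (s : seq 'I_k) u :
  0 < T -> (forall t, `|tau t| <= 1) ->
  (forall u', (forall l i, `|u' l ord0 i| <= T) -> `|tensor_form tau u'| <= B) ->
  (forall l, \sum_i u l ord0 i ^+ 2 <= n%:R) ->
  (forall l, l \notin s -> forall i, `|u l ord0 i| <= T) ->
  `|tensor_form tau u| <= B + (size s)%:R * (n%:R ^+ k / T).
Proof.
move=> T0 tau1 bB; elim: s u => [|l s IH] u u2 uT.
  by rewrite mul0r addr0; apply: bB => l i; apply: uT.
pose a := replace u l (low_part T (u l)).
have -> : tensor_form tau u =
    tensor_form tau a + tensor_form tau (replace u l (u l - low_part T (u l))).
  rewrite tensor_form_replaceB addrC subrK.
  by apply: eq_tensor_form => m; rewrite replace_id.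
rewrite /= -natr1 mulrDl mul1r addrA.
apply: le_trans (ler_normD _ _) _; apply: lerD.
  apply: IH => [m|m ms i]; rewrite /a /replace; case: eqP => [_|/eqP ml] //.
  - exact: le_trans (low_part_sqr _ _) (u2 l).
  - exact: low_part_bound (ltW T0).
  - by apply: uT; rewrite inE negb_or ml.
apply: le_trans (tensor_form_le_norm1 _ _ tau1) _.
(* Slot [l] carries the high part, of l1-norm at most [n / T]; each other slot has l1-norm at most
   [n]. *)
have -> : n%:R ^+ k / T = \prod_(m < k) (if m == l then n%:R / T else n%:R).
  rewrite (bigD1 l)//= eqxx (eq_bigr (fun=> n%:R)); last by move=> m /negPf ->.
  rewrite -[X in _ ^+ X]card_ord -prodr_const (bigD1 l)//=.
  by rewrite mulrAC.
apply: ler_prod => m _; apply/andP; split; first exact: sumr_ge0.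
rewrite /replace; case: eqP => _; first exact: norm1_high_part.
exact: norm1_le.
Qed.

(* The best bounded vector in a given slot is the difference of the indicators
   of the sets where the coefficient of the linear form is positive, negative. *)
Lemma tensor_form_round tau T (B : R) (s : seq 'I_k) u :
  0 <= T -> uniq s ->
  (forall S, `|tensor_form tau (fun l => indicator (S l))| <= B) ->
  (forall l, l \in s -> forall i, `|u l ord0 i| <= T) ->
  (forall l, l \notin s -> exists A, u l = indicator A) ->
  `|tensor_form tau u| <= (2 * T) ^+ size s * B.
Proof.
move=> T0 + bB; elim: s u => [|l s IH] u us uT uI.
  (* No slot is left to round: every vector is an indicator, and choice collects the sets into a
     family. *)
  rewrite mul1r; have [S SP] := choice (fun l => uI l isT).
  by rewrite (eq_tensor_form _ _ _ SP).
move: us => /=/andP[ls us].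
have rep A : `|tensor_form tau (replace u l (indicator A))| <= (2 * T) ^+ size s * B.
  (* Uniqueness keeps [l] out of [s], so the new indicator need not be bounded by [T], which may be
     below 1. *)
  apply: IH => // m ms; rewrite /replace; case: eqP => [mE|/eqP ml].
  - by rewrite mE (negPf ls) in ms.
  - by apply: uT; rewrite inE ms orbT.
  - by exists A.
  - by apply: uI; rewrite inE negb_or ml.
set c := slot_coef tau u l.
rewrite (eq_tensor_form _ _ (replace u l (u l))); last by move=> m; rewrite replace_id.
rewrite tensor_form_replace -/c.
apply: (@le_trans _ _ (T * \sum_i `|c i|)).
  apply: le_trans (ler_norm_sum _ _ _) _; rewrite mulr_sumr; apply: ler_sum => i _.
  by rewrite normrM mulrC ler_wpM2r// uT// mem_head.
have -> : \sum_i `|c i| = tensor_form tau (replace u l (indicator [set i | 0 <= c i]))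
    - tensor_form tau (replace u l (indicator [set i | c i < 0])).
  rewrite !tensor_form_replace -sumrB; apply: eq_bigr => i _.
  rewrite !mxE !inE -/c; case: ler0P => ci; case: ltgtP ci => //= ci _; lra.
(* Two forms, each bounded by [rep], give the factor 2 that joins [T]. *)
have := rep [set i | 0 <= c i]; have := rep [set i | c i < 0].
rewrite exprS -mulrA [2 * T]mulrC -mulrA !ler_norml => /andP[? ?] /andP[? ?].
by rewrite ler_wpM2l//; lra.
Qed.

End TensorForm.

Section Discrepancy.
Variables (R : realType) (k n : nat) (H : dikgraph k n).

Definition deviation : tensor R k n :=
  [ffun t => adjacency_tensor R H t - density R H * ones_tensor R k n t].

Lemma edges_le : (#|edges H| <= n ^ k)%N.
Proof. by apply: leq_trans (max_card _) _; rewrite card_tuple card_ord. Qed.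

Lemma deviation_le1 t : `|deviation t| <= 1.
Proof.
rewrite !ffunE mulr1.
have : 0 <= density R H <= 1.
  rewrite /density divr_ge0 ?exprn_ge0//=.
  (* If [n ^ k] is 0, the density is 0 because the inverse of 0 is 0. *)
  have [->|nk0] := eqVneq (n%:R ^+ k : R) 0; first by rewrite invr0 mulr0.
  by rewrite ler_pdivrMr ?lt0r ?nk0 ?exprn_ge0// mul1r -natrX ler_nat edges_le.
move=> /andP[d0 d1]; rewrite ler_norml.
by case: (t \in _) => /=; apply/andP; split; lra.
Qed.

(** A product of indicators tests membership of the tuple in the box, and the all-ones part factors
    over the slots. *)
Lemma deviation_indicator (S : 'I_k -> {set 'I_n}) :
  tensor_form deviation (fun l => indicator R n (S l)) =
  (edge_count H S)%:R - density R H * \prod_(l < k) #|S l|%:R.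
Proof.
have ind_prod t : \prod_(l < k) indicator R n (S l) ord0 (tnth t l) =
    [forall l : 'I_k, tnth t l \in S l]%:R.
  under eq_bigr do rewrite mxE.
  have [/forallP tS|/forallPn[l tl]] := boolP [forall l, tnth t l \in S l].
    by rewrite big1// => l _; rewrite tS.
  by rewrite (bigD1 l)//= (negPf tl) mul0r.
rewrite /tensor_form /deviation.
under eq_bigr do rewrite !ffunE mulr1 mulrBl.
rewrite sumrB -mulr_sumr (sum_tuple_prod _ _ _ (fun l i => indicator R n (S l) ord0 i)).
congr (_ - _ * _).
  under eq_bigr do rewrite ind_prod -natrM mulnb.
  rewrite -natr_sum /edge_count -sum1_card; congr _%:R.
  rewrite [RHS]big_mkcond; apply: eq_bigr => t _.
  by rewrite !inE; case: (_ && _).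
apply: eq_bigr => l _; under eq_bigr do rewrite mxE.
rewrite -natr_sum -sum1_card; congr _%:R.
by rewrite [RHS]big_mkcond; apply: eq_bigr => i _; case: (_ \in _).
Qed.

Lemma prod_card_le (S : 'I_k -> {set 'I_n}) :
  \prod_(l < k) #|S l|%:R <= n%:R ^+ k :> R.
Proof.
rewrite -[X in _ ^+ X]card_ord -prodr_const; apply: ler_prod => l _.
by rewrite ler0n ler_nat -[X in (_ <= X)%N]card_ord max_card.
Qed.

Lemma deviation_indicator_le (delta : R) (S : 'I_k -> {set 'I_n}) :
  (0 < n)%N -> Disc delta H ->
  `|tensor_form deviation (fun l => indicator R n (S l))|
    <= 2 * delta * n%:R ^+ k.
Proof.
move=> n0 [q [_ qS]]; rewrite deviation_indicator.
have nk0 : 0 < n%:R ^+ k :> R by rewrite exprn_gt0// ltr0n.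
have pq : `|density R H - q| <= delta.
  have := qS (fun=> [set: 'I_n]); rewrite prodr_const cardsT !card_ord.
  have -> : edge_count H (fun=> [set: 'I_n]) = #|edges H|.
    apply: eq_card => t; rewrite !inE.
    by case: (t \in _) => //=; apply/forallP => l; rewrite inE.
  have -> : #|edges H|%:R = density R H * n%:R ^+ k by rewrite /density divfK ?gt_eqF.
  by rewrite -mulrBl normrM (gtr0_norm nk0) ler_pM2r.
have P0 : 0 <= \prod_(l < k) #|S l|%:R :> R by rewrite prodr_ge0.
have := qS S; have := prod_card_le S.
set P := \prod_(l < k) _ in P0 *; set e := (edge_count H S)%:R => PN eq.
(* One [delta] comes from the discrepancy of [S], the other from exchanging [q] for the density. *)
have -> : e - density R H * P = (e - q * P) - (density R H - q) * P by ring.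
apply: le_trans (ler_normB _ _) _.
rewrite -mulrA mulr_natl mulr2n; apply: lerD => //.
by rewrite normrM (ger0_norm P0) ler_pM.
Qed.

End Discrepancy.

Theorem theorem3 :
  forall (R : realType) (k : nat), (2 <= k)%N ->
  forall eps : R, 0 < eps ->
  exists delta : R, 0 < delta /\
    forall (n : nat) (H : dikgraph k n), Disc delta H -> Eig eps H.
Proof.
move=> R k k2 eps eps0.
have k0 : 0 < k%:R :> R by rewrite ltr0n ltnW.
(* Makes the total truncation error [k * n ^ k / T] equal to half of [eps * n ^ k]. *)
pose T : R := 2 * k%:R / eps.
have T0 : 0 < T by rewrite divr_gt0 ?mulr_gt0.
have TT0 : 0 < (2 * T) ^+ k by rewrite exprn_gt0// mulr_gt0.
(* Makes the rounded part [(2 * T) ^ k * (2 * delta * n ^ k)] the other half. *)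
pose delta := eps / (4 * (2 * T) ^+ k).
exists delta; split=> [|n H HD]; first by rewrite divr_gt0// mulr_gt0.
have rhs0 : 0 <= eps * (n%:R `^ (k%:R / 2)) by rewrite mulr_ge0 ?powR_ge0 ?ltW.
rewrite /Eig /lambda2 /lambda_max; set E := (X in sup X).
(* Without unit vectors the supremum is 0 by default. *)
have [->|/set0P E0] := eqVneq E set0; first by rewrite sup0.
apply: ge_sup => //.
move=> _ [u [u1 ->]].
have u_sqr l : \sum_i u l ord0 i ^+ 2 = 1.
  rewrite -[LHS]sqr_sqrtr; last by apply: sumr_ge0 => i _; exact: sqr_ge0.
  by rewrite -/(norm2 (u l)) u1 expr1n.
have n0 : (0 < n)%N.
  rewrite lt0n; apply/eqP => n_eq0; subst n.
  by have := u_sqr (Ordinal (ltnW k2)); rewrite big_ord0 => /esym/eqP; rewrite oner_eq0.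
set f := [ffun t => _]; have -> : f = deviation R k n H by [].
set r : R := Num.sqrt n%:R.
have r0 : 0 < r by rewrite sqrtr_gt0 ltr0n.
have r2 : r ^+ 2 = n%:R by rewrite sqr_sqrtr.
have -> : n%:R `^ (k%:R / 2) = r ^+ k.
  by rewrite mulrC powRrM powR12_sqrt// powR_mulrn// sqrtr_ge0.
(* Multiply by [r ^ k]: on the left homogeneity absorbs it into the vectors, on the right it
   completes [n ^ k]. *)
rewrite -(ler_pM2l (exprn_gt0 k r0)) mulrCA -exprMn -expr2 r2.
rewrite -{1}(gtr0_norm (exprn_gt0 k r0)) -normrM -tensor_formZ.
have -> : eps * n%:R ^+ k = (2 * T) ^+ size (enum 'I_k) * (2 * delta * n%:R ^+ k)
    + (size (enum 'I_k))%:R * (n%:R ^+ k / T).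
  rewrite size_enum_ord /delta /T; move: TT0; rewrite /T; set X := _ ^+ k => X0.
  by field; rewrite !gt_eqF.
(* Both inductions run over [enum 'I_k], so their conditions on slots outside the list are
   vacuous. *)
apply: tensor_form_truncate => //.
- exact: deviation_le1.
- move=> v vT; apply: tensor_form_round (ltW T0) (enum_uniq _) _ _ _ => //.
  + by move=> S; apply: deviation_indicator_le.
  + by move=> l; rewrite mem_enum.
- move=> l; under eq_bigr do rewrite mxE exprMn.
  by rewrite -mulr_sumr u_sqr mulr1 r2.
- by move=> l; rewrite mem_enum.
Qed.
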